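(* Let $G=(V,E)$ be a graph and let $k\in\mathbb{Z}$ with $k\ge 2$ and $k\,(\omega(G)+|V|)$ even. Then $G$ is critical if and only if $k\,\Psi(G)=\Psi(\nabla^k G)$.
   Context: All graphs are finite and simple; $|G|=|V|$ denotes the number of vertices of $G$. A coloring of a graph $G=(V,E)$ is a surjective map $\ell:V\to C$ onto a finite set $C$ of colors; it need not be proper. It is pseudocomplete if for any two distinct colors $i,j\in C$ there is an edge $uv\in E$ with $\{\ell(u),\ell(v)\}=\{i,j\}$. The pseudoachromatic number $\Psi(G)$ is the greatest number of colors used in a pseudocomplete coloring of $G$ (so $\Psi$ of the graph with no vertices is $0$). $\omega(G)$ is the clique number. $\nabla^k G$ is the join of $k$ copies of $G$: the disjoint union of $k$ copies of $G$ together with all edges between vertices in different copies. For an integer $0\le j\le |G|$, $\operatorname{mpd}_G(j)=\min\{\Psi(G)-\Psi(G\setminus X) : X\subseteq V,\ |X|=j\}$, where $G\setminus X$ is the subgraph induced on $V\setminus X$. $G$ is critical if $\operatorname{mpd}_G(j)\ge\lceil j/2\rceil$ for all $0\le j\le |G|$. *)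

(* Defs.v *)
From mathcomp Require Import all_boot.

Set Implicit Arguments.
Unset Strict Implicit.
Unset Printing Implicit Defensive.

Record sgraph := SGraph {
  vertex :> finType;
  edge : rel vertex;
  edge_sym : symmetric edge;
  edge_irrefl : irreflexive edge
}.

Section GraphParameters.
Variable G : sgraph.

Definition is_clique (K : {set G}) : bool :=
  [forall u in K, forall v in K, (u != v) ==> edge u v].

Definition omega : nat := \max_(K : {set G} | is_clique K) #|K|.

Definition is_coloring (C : finType) (l : {ffun G -> C}) : bool :=
  [forall c, exists v, l v == c].

Definition pseudocomplete (C : finType) (l : {ffun G -> C}) : bool :=
  is_coloring l &&
  [forall i, forall j, (i != j) ==>
     [exists u, exists v, [&& edge u v, l u == i & l v == j]]].

Definition pc_colorable (n : nat) : bool :=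
  [exists l : {ffun G -> 'I_n}, pseudocomplete l].

(* A coloring is onto its set of colors, so it has at most #|G| colors and the
   bound on n excludes nothing; see Psi_max. *)
Definition Psi : nat := \max_(n < #|G|.+1 | pc_colorable n) n.

Lemma pc_colorable_card n : pc_colorable n -> n <= #|G|.
Proof.
case/existsP=> l /andP[/forallP onto_l _].
rewrite -[n]card_ord -(card_codom (f := fun c => xchoose (existsP (onto_l c)))).
  exact: max_card.
move=> c d eq_cd.
by rewrite -(eqP (xchooseP (existsP (onto_l c)))) eq_cd
           (eqP (xchooseP (existsP (onto_l d)))).
Qed.

Lemma Psi_max n : pc_colorable n -> n <= Psi.
Proof.
move=> Hn; have ltn : n < #|G|.+1 by rewrite ltnS pc_colorable_card.
exact: (@leq_bigmax_cond _ _ (fun i : 'I_#|G|.+1 => i : nat) (Ordinal ltn)).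
Qed.

Lemma pc_colorable0 : #|G| = 0 -> pc_colorable 0.
Proof.
move=> G0; apply/existsP.
have f (x : G) : 'I_0 by have := fintype0 x G0.
exists [ffun x => f x].
by apply/andP; split; [apply/forallP=> -[] | apply/forallP=> -[]].
Qed.

Lemma pc_colorable1 : 0 < #|G| -> pc_colorable 1.
Proof.
case/card_gt0P=> x _; apply/existsP; exists [ffun=> ord0].
apply/andP; split; apply/forallP=> c.
  by apply/existsP; exists x; rewrite ffunE (ord1 c).
by apply/forallP=> d; rewrite (ord1 c) (ord1 d) eqxx.
Qed.

Lemma Psi_attained : pc_colorable Psi.
Proof.
have [n0 [lt_n0 Hn0]] : exists n, n < #|G|.+1 /\ pc_colorable n.
  have [G0|G0] := posnP #|G|; first by exists 0; rewrite pc_colorable0.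
  by exists 1; rewrite pc_colorable1 // ltnS.
rewrite /Psi (bigmax_eq_arg (Ordinal lt_n0)) //.
by case: arg_maxnP.
Qed.

End GraphParameters.

Section Deletion.
Variables (G : sgraph) (X : {set G}).

Definition del_vertex : finType := {x : G | x \notin X}.
Definition del_edge : rel del_vertex := fun u v => edge (val u) (val v).

Lemma del_edge_sym : symmetric del_edge.
Proof. by move=> u v; apply: edge_sym. Qed.
Lemma del_edge_irrefl : irreflexive del_edge.
Proof. by move=> u; apply: edge_irrefl. Qed.

Definition del : sgraph := SGraph del_edge_sym del_edge_irrefl.

Lemma Psi_del_le : Psi del <= Psi G.
Proof.
case E: (Psi del) => [|n] //; apply: Psi_max.
have /existsP[l /andP[/forallP onto_l /forallP pc_l]] : pc_colorable del n.+1.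
  by rewrite -E Psi_attained.
pose m (x : G) : 'I_n.+1 :=
  if insub x : option del is Some y then l y else ord0.
have mE (y : del) : m (val y) = l y by rewrite /m valK.
apply/existsP; exists [ffun x => m x]; apply/andP; split.
  apply/forallP=> c; have /existsP[y Hy] := onto_l c.
  by apply/existsP; exists (val y); rewrite ffunE mE.
apply/forallP=> i; apply/forallP=> j; apply/implyP=> ij.
have /existsP[u /existsP[v /and3P[uv ui vj]]] := implyP (forallP (pc_l i) j) ij.
apply/existsP; exists (val u); apply/existsP; exists (val v).
by rewrite !ffunE !mE ui vj !andbT; apply: uv.
Qed.

End Deletion.

Section Join.
Variables (k : nat) (G : sgraph).

Definition joink_edge : rel ('I_k * G)%type :=
  fun p q => (p.1 != q.1) || edge p.2 q.2.

Lemma joink_edge_sym : symmetric joink_edge.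
Proof. by move=> p q; rewrite /joink_edge eq_sym edge_sym. Qed.
Lemma joink_edge_irrefl : irreflexive joink_edge.
Proof. by move=> p; rewrite /joink_edge eqxx edge_irrefl. Qed.

Definition joink : sgraph := SGraph joink_edge_sym joink_edge_irrefl.

End Join.

Section Critical.
Variable G : sgraph.

(* The subtraction is never truncated (Psi_del_le).  For j <= #|G| the family
   is nonempty with all values at most Psi G, so the default Psi G of the
   iterated minimum is harmless (mpd_min, mpd_attained). *)
Definition mpd (j : nat) : nat :=
  \big[minn/Psi G]_(X : {set G} | #|X| == j) (Psi G - Psi (del X)).

Lemma mpd_min (X : {set G}) : mpd #|X| <= Psi G - Psi (del X).
Proof.
rewrite /mpd; elim: (index_enum _) (mem_index_enum X) => //= Y s IHs.
rewrite inE big_cons => /predU1P[<-|/IHs le_s]; first by rewrite eqxx geq_minl.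
by case: ifP => // _; apply: leq_trans le_s; apply: geq_minr.
Qed.

Lemma mpd_attained j : j <= #|G| ->
  exists2 X : {set G}, #|X| = j & mpd j = Psi G - Psi (del X).
Proof.
move=> le_jG.
have [X0 X0j] : exists X : {set G}, #|X| == j.
  exists [set x in take j (enum G)].
  rewrite cardsE (card_uniqP _) ?take_uniq ?enum_uniq //.
  by rewrite size_takel // -cardE.
have : mpd j = Psi G \/
    exists2 X : {set G}, #|X| = j & mpd j = Psi G - Psi (del X).
  apply: (big_ind (fun m => m = Psi G \/
    exists2 X : {set G}, #|X| = j & m = Psi G - Psi (del X))); first by left.
    by move=> a b Ha Hb; rewrite /minn; case: ifP.
  by move=> X /eqP Xj; right; exists X.
case=> // E; exists X0; first exact/eqP.
apply/eqP; rewrite eqn_leq -{1}(eqP X0j) mpd_min /=.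
by rewrite E leq_subr.
Qed.

Definition critical : Prop := forall j, j <= #|G| -> uphalf j <= mpd j.

End Critical.

(* Main.v *)
Require Import Defs.
From mathcomp Require Import all_boot zify.

Set Implicit Arguments.
Unset Strict Implicit.
Unset Printing Implicit Defensive.

(** Write w for the clique number and n for the number of vertices of G.  Both
    sides of the equivalence say that 2 Psi(G) attains the upper bound w + n.

    That bound holds for every graph ([Psi_double_le]): in a pseudocomplete
    coloring the vertices that are alone in their class form a clique, so there
    are at most w classes of size one; the others have at least two vertices.

    If the bound is attained, then deleting j vertices lowers the bound by at
    least j, hence Psi by at least j / 2, so G is critical.  Conversely, deleting
    everything outside a maximum clique leaves a graph with Psi = w, and
    criticality for this one deletion already gives 2 Psi(G) >= w + n
    ([criticalE]).

    In the k-fold join, which has clique number k w and k n vertices, the bound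
    is always attained when k >= 2 and k (w + n) is even ([Psi_joink]).  Take a
    maximum clique of each copy and make its vertices classes of size one.
    Match the k (n - w) remaining vertices into pairs that lie in two different
    copies; each pair is a class.  A pair has a vertex outside any given copy,
    so it is adjacent to every other class.  Thus k Psi(G) = Psi(join) says
    that k Psi(G) = k (w + n) / 2. *)

(** * The upper bound on Psi *)

Lemma omega_max (G : sgraph) (K : {set G}) : is_clique K -> #|K| <= omega G.
Proof. by move=> cK; apply: (@leq_bigmax_cond _ _ (fun K : {set G} => #|K|)). Qed.

Lemma omega_attained (G : sgraph) : exists2 K : {set G}, is_clique K & #|K| = omega G.
Proof.
have c0 : is_clique (set0 : {set G}) by apply/forall_inP=> u; rewrite inE.
rewrite /omega (bigmax_eq_arg set0) //.
by case: arg_maxnP => // K cK _; exists K.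
Qed.

Lemma is_cliqueP (G : sgraph) (K : {set G}) :
  reflect {in K &, forall u v, u != v -> edge u v} (is_clique K).
Proof.
apply: (iffP forall_inP) => [cK u v uK vK uv | cK u uK].
  exact: (implyP (forall_inP (cK u uK) v vK)).
by apply/forall_inP=> v vK; apply/implyP; apply: cK.
Qed.

(** Two vertices that are each alone in their class are adjacent, since an edge
    between the two classes can only join these vertices.  So at most
    [omega G] classes have size one, and counting vertices class by class gives
    the bound. *)
Lemma Psi_double_le (G : sgraph) : (Psi G).*2 <= omega G + #|G|.
Proof.
have /existsP[l /andP[/forallP onto_l /forallP pc_l]] := Psi_attained G.
set n := Psi G in l onto_l pc_l *.
pose cls c : {set G} := [set v | l v == c].
pose K : {set G} := [set v | #|cls (l v)| == 1].
have alone u v : u \in K -> l v = l u -> v = u.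
  rewrite inE => /cards1P[x Ex] lvu.
  have: v \in cls (l u) by rewrite inE lvu.
  have: u \in cls (l u) by rewrite inE.
  by rewrite Ex !inE => /eqP-> /eqP->.
have /omega_max leKw : is_clique K.
  apply/is_cliqueP=> u v uK vK uv.
  have luv : l u != l v by apply: contra uv => /eqP/(alone _ _ vK)->.
  have /existsP[x /existsP[y /and3P[xy /eqP xu /eqP yv]]] :=
    implyP (forallP (pc_l (l u)) (l v)) luv.
  by rewrite -(alone _ _ uK xu) -(alone _ _ vK yv).
have cls_gt0 c : 0 < #|cls c|.
  by have /existsP[v lv] := onto_l c; apply/card_gt0P; exists v; rewrite inE.
have leSK : \sum_c (#|cls c| == 1) <= #|K|.
  rewrite -big_mkcond sum1_card.
  apply: leq_trans (leq_imset_card l K); apply: subset_leq_card.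
  apply/subsetP=> c c1.
  have /existsP[v /eqP lv] := onto_l c.
  by apply/imsetP; exists v; rewrite ?inE ?lv.
have sum_cls : \sum_c #|cls c| = #|G|.
  rewrite -sum1_card (partition_big l xpredT) //=.
  by apply: eq_bigr => c _; rewrite -sum1_card; apply: eq_bigl => v; rewrite inE.
have : n.*2 <= \sum_c ((#|cls c| == 1) + #|cls c|).
  rewrite -muln2 -[n in n * 2]card_ord -sum_nat_const.
  by apply: leq_sum => c _; have := cls_gt0 c; case: #|cls c| => [|[]].
rewrite big_split /= sum_cls => /leq_trans-> //.
by rewrite leq_add2r (leq_trans leSK).
Qed.

Lemma pseudocomplete_card (G : sgraph) (C : finType) (l : {ffun G -> C}) :
  pseudocomplete l -> #|C| <= Psi G.
Proof.
case/andP=> /forallP onto_l /forallP pc_l; apply: Psi_max.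
apply/existsP; exists [ffun x => enum_rank (l x)]; apply/andP; split.
  apply/forallP=> c; have /existsP[v /eqP lv] := onto_l (enum_val c).
  by apply/existsP; exists v; rewrite ffunE lv enum_valK.
apply/forallP=> i; apply/forallP=> j; apply/implyP=> ij.
have ij' : enum_val i != enum_val j by rewrite (inj_eq enum_val_inj).
have /existsP[u /existsP[v /and3P[uv /eqP ui /eqP vj]]] :=
  implyP (forallP (pc_l _) _) ij'.
apply/existsP; exists u; apply/existsP; exists v.
by rewrite !ffunE uv ui vj !enum_valK !eqxx.
Qed.

(** * Criticality means that the bound is attained *)

Lemma card_del (G : sgraph) (X : {set G}) : #|del X| + #|X| = #|G|.
Proof.
rewrite card_sig addnC -(cardC X).
by congr (_ + _); apply: eq_card => x; rewrite !inE.
Qed.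

Lemma omega_del_le (G : sgraph) (X : {set G}) : omega (del X) <= omega G.
Proof.
have [K /is_cliqueP cK <-] := omega_attained (del X).
rewrite -(card_imset _ val_inj); apply/omega_max/is_cliqueP.
move=> _ _ /imsetP[u uK ->] /imsetP[v vK ->].
by rewrite (inj_eq val_inj); apply: cK.
Qed.

(** In the clique induced on K, giving each vertex its own color is
    pseudocomplete. *)
Lemma Psi_clique (G : sgraph) (K : {set G}) :
  is_clique K -> #|K| <= Psi (del (~: K)).
Proof.
move=> /is_cliqueP cK.
have -> : #|K| = #|del (~: K)|.
  by have := card_del (~: K); have := cardsC K; lia.
apply: (@pseudocomplete_card _ _ [ffun x => x]); apply/andP; split.
  by apply/forallP=> c; apply/existsP; exists c; rewrite ffunE.
apply/forallP=> i; apply/forallP=> j; apply/implyP=> ij.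
apply/existsP; exists i; apply/existsP; exists j.
have inK (x : del (~: K)) : val x \in K by have := valP x; rewrite inE negbK.
by rewrite !ffunE !eqxx !andbT; apply: cK; rewrite ?inK ?(inj_eq val_inj).
Qed.

(** Only one deletion matters for criticality: that of the complement of a
    maximum clique.  There the clique number stays the same while the number of
    vertices drops to it. *)
Lemma criticalE (G : sgraph) : critical G <-> (Psi G).*2 = omega G + #|G|.
Proof.
split=> [crG | attained j le_jG].
  have [K cK cardK] := omega_attained G.
  have := crG #|~: K| (max_card _).
  have := mpd_min (~: K); have := Psi_clique cK; have := cardsC K.
  have := Psi_del_le (~: K); have := Psi_double_le G; rewrite uphalfE; lia.
have [X cardX ->] := mpd_attained le_jG.
have := Psi_double_le (del X); have := omega_del_le X; have := card_del X.
by rewrite uphalfE; lia.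
Qed.

(** * The join attains the bound *)

Lemma omega_joink_le (k : nat) (G : sgraph) : omega (joink k G) <= k * omega G.
Proof.
have [K /is_cliqueP cK <-] := omega_attained (joink k G).
pose slice i : {set G} := [set x | (i, x) \in K].
have -> : #|K| = \sum_i #|slice i|.
  rewrite -sum1_card (partition_big (fun p : joink k G => p.1) xpredT) //=.
  apply: eq_bigr => i _; rewrite -sum1_card.
  rewrite (reindex_onto (pair i) snd) /=; last by case=> j x /andP[_ /eqP <-].
  by apply: eq_bigl => x; rewrite !inE !eqxx !andbT.
rewrite -[k in k * _]card_ord -sum_nat_const; apply: leq_sum => i _.
apply/omega_max/is_cliqueP=> u v; rewrite !inE => uK vK uv.
have := cK _ _ uK vK; rewrite /edge /= /joink_edge /= eqxx /=; apply.
by apply: contra uv => /eqP[->].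
Qed.

(** List the vertices of k disjoint copies of T copy by copy and match the first
    half of the list with the second half, in order.  Partners are half of the
    list apart, and this is at least #|T| since k >= 2, so they lie in different
    copies. *)
Lemma cross_matching (k : nat) (T : finType) : 2 <= k -> ~~ odd (k * #|T|) ->
  exists g : 'I_k * T -> 'I_(k * #|T|)./2,
  forall c, exists p q, [/\ g p = c, g q = c & p.1 != q.1].
Proof.
move=> k2 even_kT; set h := (k * #|T|)./2.
have hE : h + h = k * #|T| by rewrite addnn /h; lia.
have h_gt0 (p : 'I_k * T) : 0 < h.
  have : 0 < #|T| by apply/card_gt0P; exists p.2.
  by nia.
pose g (p : 'I_k * T) : 'I_h :=
  Ordinal (ltn_pmod (p.1 * #|T| + enum_rank p.2) (h_gt0 p)).
have at_pos t : t < k * #|T| ->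
    exists2 p : 'I_k * T, p.1 = t %/ #|T| :> nat & g p = t %% h :> nat.
  move=> lt_t; have T_gt0 : 0 < #|T| by case: #|T| lt_t => //; rewrite muln0.
  have lt_q : t %/ #|T| < k by rewrite ltn_divLR.
  exists (Ordinal lt_q, enum_val (Ordinal (ltn_pmod t T_gt0))) => //=.
  by rewrite enum_valK /= -divn_eq.
exists g => c; have lt_ch := ltn_ord c.
have [|p p1 gp] := at_pos c; first by lia.
have [|q q1 gq] := at_pos (c + h); first by lia.
exists p, q; split; [apply: ord_inj | apply: ord_inj |].
- by rewrite gp modn_small.
- by rewrite gq modnDr modn_small.
have T_gt0 : 0 < #|T| by apply/card_gt0P; exists p.2.
apply/eqP=> /(congr1 val) /= ; rewrite p1 q1.
have le_Th : #|T| <= h by nia.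
have := leq_div2r #|T| (leq_add (leqnn c) le_Th); rewrite divnDr // divnn T_gt0.
by lia.
Qed.

(** A maximum clique K of G gives k #|K| singleton classes, and a cross matching
    of the copies of the complement of K gives the other classes.  Given a
    vertex in copy i, a matched pair has a vertex outside copy i, which is
    adjacent to it; this settles all pairs of classes but two singletons. *)
Lemma Psi_joink_ge (k : nat) (G : sgraph) :
  2 <= k -> ~~ odd (k * (omega G + #|G|)) ->
  k * (omega G + #|G|) <= (Psi (joink k G)).*2.
Proof.
move=> k2 even_k; have [K /is_cliqueP cK cardK] := omega_attained G.
pose A : finType := {x : G | x \in K}; pose B : finType := {x : G | x \notin K}.
have cardA : #|A| = omega G by rewrite card_sig -cardK.
have cardB : omega G + #|B| = #|G|.
  by rewrite addnC -cardK; apply: card_del.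
have even_B : ~~ odd (k * #|B|) by lia.
have [g gP] := cross_matching k2 even_B.
pose col (p : joink k G) : ('I_k * A) + 'I_(k * #|B|)./2 :=
  match boolP (p.2 \in K) with
  | AltTrue xK => inl (p.1, exist _ p.2 xK)
  | AltFalse xK => inr (g (p.1, exist _ p.2 xK))
  end.
have colA i (y : A) : col (i, val y) = inl (i, y).
  rewrite /col /=; case: {-}_ / boolP => [yK | /negP[]]; last exact: (valP y).
  by congr (inl (_, _)); apply: val_inj.
have colB i (z : B) : col (i, val z) = inr (g (i, z)).
  rewrite /col /=; case: {-}_ / boolP => [zK | zK]; first by have := valP z; rewrite zK.
  by congr (inr (g (_, _))); apply: val_inj.
have avoid (i : 'I_k) c : exists2 p : joink k G, col p = inr c & i != p.1.
  have [[a x] [[b y] [gx gy /= ab]]] := gP c.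
  have [ia|ia] := eqVneq i a.
    by exists (b, val y); rewrite ?colB ?gy // ia.
  by exists (a, val x); rewrite ?colB ?gx.
have edgeN (p q : joink k G) : p.1 != q.1 -> edge p q.
  by rewrite /edge /= /joink_edge => ->.
have /pseudocomplete_card : pseudocomplete [ffun p => col p].
  have onto c : exists p, col p = c.
    case: c => [[i y]|c]; first by exists (i, val y).
    have [p [_ [gp _ _]]] := gP c.
    by exists (p.1, val p.2); rewrite colB -surjective_pairing gp.
  apply/andP; split.
    apply/forallP=> c; have [p pc] := onto c.
    by apply/existsP; exists p; rewrite ffunE pc.
  apply/forallP=> c; apply/forallP=> d; apply/implyP=> cd.
  suff [p [q [pq pc qd]]] : exists p q, [/\ edge p q, col p = c & col q = d].
    apply/existsP; exists p; apply/existsP; exists q.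
    by rewrite !ffunE pq pc qd !eqxx.
  case: d cd => [[j z]|d] cd; last first.
    have [p pc] := onto c; have [q qd pq] := avoid p.1 d.
    by exists p, q; split; rewrite ?edgeN.
  case: c cd => [[i y]|c] cd; last first.
    have [p pc jp] := avoid j c.
    by exists p, (j, val z); split=> //; apply: edgeN; rewrite eq_sym.
  exists (i, val y), (j, val z); split=> //.
  rewrite /edge /= /joink_edge /=; case: (eqVneq i j) cd => //= -> cd.
  apply: cK; rewrite ?(valP y) ?(valP z) //.
  by apply: contra cd => /eqP/val_inj->.
rewrite card_sum card_prod !card_ord cardA; lia.
Qed.

Lemma Psi_joink (k : nat) (G : sgraph) :
  2 <= k -> ~~ odd (k * (omega G + #|G|)) ->
  (Psi (joink k G)).*2 = k * (omega G + #|G|).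
Proof.
move=> k2 even_k; apply/eqP; rewrite eqn_leq Psi_joink_ge // andbT.
apply: leq_trans (Psi_double_le _) _.
by rewrite card_prod card_ord mulnDr leq_add2r omega_joink_le.
Qed.

Theorem theorem5p4 (G : sgraph) (k : nat) :
  2 <= k -> ~~ odd (k * (omega G + #|G|)) ->
  critical G <-> k * Psi G = Psi (joink k G).
Proof.
move=> k2 even_k; rewrite criticalE.
have k_gt0 : 0 < k by exact: ltnW.
have join_bound := Psi_joink k2 even_k.
split=> [attained | eq_k].
  by apply: double_inj; rewrite join_bound -attained doubleMr.
by apply/eqP; rewrite -(eqn_pmul2l k_gt0) -doubleMr eq_k join_bound.
Qed.
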